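(* The family of $8$-regular graphs coming from the fields $F_p[x]/(x^2+1)$, where $p$ runs over the primes with $p\equiv 3 \pmod 4$ and $p\to\infty$, is not an expander family. That is, writing $\lambda_1(p)$ for the smallest non-trivial eigenvalue of the Laplacian of the graph $X_f$ with $f=x^2+1\in F_p[x]$, there is no constant $\varepsilon>0$ such that $\lambda_1(p)\geq\varepsilon$ for all primes $p\equiv 3\pmod 4$.
   Context: For a prime $p\equiv 3\pmod 4$ the polynomial $f=x^2+1$ is irreducible over the field $F_p$ with $p$ elements, so $K_f=F_p[x]/(f)$ is a field with $p^2$ elements. Let $x$ also denote its class in $K_f$ and let $S=\{x,x^p\}=\{x,-x\}\subset K_f$. The undirected multigraph $X_f$ has vertex set $K_f$ and the following edges. For all $y,z\in K_f$ and $s\in S$ with $z-y=s$ there is one (additive) edge between $y$ and $z$, for each such ordered pair $(y,z)$ and each $s$. For all $y,z\in K_f\setminus\{0\}$ and $s\in S$ with $zy^{-1}=s$ there is one (multiplicative) edge between $y$ and $z$, again for each such ordered pair and each $s$. Edges are counted with multiplicity. Every nonzero vertex has degree $8$ and the vertex $0$ has degree $4$; loops are added at $0$ to make the graph $8$-regular, which does not affect the Laplacian. The Laplacian acts on functions $g$ on the vertices by $\Delta g(y)=\sum (g(y)-g(z))$, where the sum is over the edges having one endpoint at $y$ and $z$ denotes the other endpoint (loops contribute nothing). It is symmetric and positive semi-definite. Its eigenvalues, listed with multiplicity, are $0=\lambda_0\leq\lambda_1\leq\cdots$, and $\lambda_1$ is the smallest non-trivial eigenvalue. A sequence of $d$-regular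 graphs ($d$ fixed) with number of vertices tending to infinity is an expander family if $\lambda_1$ is bounded below by a positive constant along the sequence. *)

(* Defs.v *)
From mathcomp Require Import all_boot all_order all_fingroup all_algebra all_field.
From mathcomp Require Import polyrcf.
From mathcomp Require Import reals.
From mathcomp Require Import zify.

Set Implicit Arguments.
Unset Strict Implicit.
Unset Printing Implicit Defensive.

Import Order.TTheory GRing.Theory Num.Theory.
Import Pdiv.CommonRing Pdiv.RingMonic.
Local Open Scope ring_scope.

(* An undirected multigraph; the order of the two endpoints of an edge is an
   artefact of the encoding, and a loop contributes 2 to the degree. *)
Record multigraph := Multigraph {
  vertex : finType;
  edge : finType;
  src : edge -> vertex;
  tgt : edge -> vertex
}.

Definition degree (G : multigraph) (y : vertex G) : nat :=
  (#|[set e : edge G | src e == y]| + #|[set e : edge G | tgt e == y]|)%N.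

Definition regular (d : nat) (G : multigraph) : Prop :=
  forall y : vertex G, degree y = d.

Definition laplacian (R : realType) (G : multigraph) (g : {ffun vertex G -> R}) :
    {ffun vertex G -> R} :=
  [ffun y => \sum_(e : edge G | src e == y) (g y - g (tgt e))
           + \sum_(e : edge G | tgt e == y) (g y - g (src e))].

(* Matrix of the Laplacian in the basis of indicator functions of vertices,
   acting on column vectors. *)
Definition laplacian_mx (R : realType) (G : multigraph) : 'M[R]_#|vertex G| :=
  \matrix_(i, j)
    laplacian [ffun z => (z == enum_val j)%:R : R] (enum_val i).

(* Real eigenvalues in increasing order, repeated according to their algebraic
   multiplicity; for a symmetric matrix these are all the eigenvalues.
   [rootsR] lists the distinct real roots in increasing order. *)
Definition eigenvalues (R : realType) (n : nat) (A : 'M[R]_n) : seq R :=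
  flatten [seq nseq (mup a (char_poly A)) a | a <- rootsR (char_poly A)].

Definition lambda1 (R : realType) (G : multigraph) : R :=
  (eigenvalues (laplacian_mx R G))`_1.

Section AddMulGraph.

Variables (K : finFieldType) (S : {set K}).

(* An edge is a triple ((y, z), s) with (y, z) ordered: if s and -s are both in
   S, then y and y + s are joined by two additive edges. *)
Definition add_edge : finType :=
  {e : K * K * K | (e.2 \in S) && (e.1.2 - e.1.1 == e.2)}.

Definition mul_edge : finType :=
  {e : K * K * K |
    [&& e.1.1 != 0, e.1.2 != 0, e.2 \in S & e.1.2 * e.1.1^-1 == e.2]}.

(* The summand ['I_#|S|] indexes the loops at 0; there are as many as needed to
   raise the degree of 0 from 2|S| to 4|S|. *)
Definition add_mul_edge : finType := (add_edge + mul_edge + 'I_#|S|)%type.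

Definition add_mul_src (e : add_mul_edge) : K :=
  match e with
  | inl (inl e) => (val e).1.1
  | inl (inr e) => (val e).1.1
  | inr _ => 0
  end.

Definition add_mul_tgt (e : add_mul_edge) : K :=
  match e with
  | inl (inl e) => (val e).1.2
  | inl (inr e) => (val e).1.2
  | inr _ => 0
  end.

Definition add_mul_graph : multigraph := Multigraph add_mul_src add_mul_tgt.

Let card_sum_set (A B : finType) (q : pred (A + B)) :
  #|[set e | q e]| = (#|[set a | q (inl a)]| + #|[set b | q (inr b)]|)%N.
Proof.
rewrite -!sum1_card !(big_mkcond (fun x => x \in _)) big_sumType /=.
by congr addn; apply: eq_bigr => e _; rewrite !inE.
Qed.

Let card_edges (P q : pred (K * K * K)) (T : {set K}) (h : K -> K * K * K) :
  injective h -> (forall t, P t && q t = (t \in h @: T)) ->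
  #|[set e : {t | P t} | q (val e)]| = #|T|.
Proof.
move=> h_inj PqE; rewrite -(card_imset _ h_inj) -(card_imset _ val_inj).
apply: eq_card => t; rewrite -PqE; apply/imsetP/andP => [[e]|[Pt qt]].
  by rewrite inE => qe ->; split=> //; apply: (valP e).
by exists (Sub t Pt); rewrite ?inE SubK.
Qed.

Lemma add_mul_graph_regular : 0 \notin S -> regular (4 * #|S|) add_mul_graph.
Proof.
move=> S0 y; rewrite /degree !card_sum_set /=.
have loopsE : #|[set _ : 'I_#|S| | 0 == y]| = if y == 0 then #|S| else 0%N.
  rewrite [y == 0]eq_sym; case: ifP => _; last by apply/eqP; rewrite cards_eq0.
  by rewrite -[RHS]card_ord -cardsT; apply: eq_card => i; rewrite !inE.
have -> : #|[set e : add_edge | (val e).1.1 == y]| = #|S|.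
  apply: (@card_edges _ (fun t => t.1.1 == y) _ (fun s => (y, y + s, s))).
    by move=> s t [].
  move=> [[u v] s] /=; apply/idP/imsetP => [|[t tS [-> -> ->]]].
    move=> /andP[/andP[sS /eqP vE] /eqP uE].
    by exists s => //; rewrite -vE uE [y + _]addrC subrK.
  by rewrite tS [y + t]addrC addrK !eqxx.
have -> : #|[set e : add_edge | (val e).1.2 == y]| = #|S|.
  apply: (@card_edges _ (fun t => t.1.2 == y) _ (fun s => (y - s, y, s))).
    by move=> s t [].
  move=> [[u v] s] /=; apply/idP/imsetP => [|[t tS [-> -> ->]]].
    move=> /andP[/andP[sS /eqP vE] /eqP uE].
    by exists s => //; rewrite -vE uE subKr.
  by rewrite tS subKr !eqxx.
rewrite !loopsE; have [->|y0] := eqVneq y 0.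
  have -> : [set e : mul_edge | (val e).1.1 == 0] = set0.
    by apply/setP => e; rewrite !inE; case/and4P: (valP e) => /negPf.
  have -> : [set e : mul_edge | (val e).1.2 == 0] = set0.
    by apply/setP => e; rewrite !inE; case/and4P: (valP e) => _ /negPf.
  by rewrite cards0 ?eqxx; move: #|S| => n; lia.
have -> : #|[set e : mul_edge | (val e).1.1 == y]| = #|S|.
  apply: (@card_edges _ (fun t => t.1.1 == y) _ (fun s => (y, s * y, s))).
    by move=> s t [].
  move=> [[u v] s] /=; apply/idP/imsetP => [|[t tS [-> -> ->]]].
    move=> /andP[/and4P[u0 v0 sS /eqP vE] /eqP uE].
    by exists s => //; rewrite -vE -uE mulfVK.
  have t0 : t != 0 by apply: contraNneq S0 => <-.
  by rewrite y0 mulf_neq0 // tS mulfK // !eqxx.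
have -> : #|[set e : mul_edge | (val e).1.2 == y]| = #|S|.
  apply: (@card_edges _ (fun t => t.1.2 == y) _ (fun s => (y / s, y, s))).
    by move=> s t [].
  move=> [[u v] s] /=; apply/idP/imsetP => [|[t tS [-> -> ->]]].
    move=> /andP[/and4P[u0 v0 sS /eqP vE] /eqP uE].
    by exists s => //; rewrite -vE -uE invf_div mulrCA mulfV ?mulr1.
  have t0 : t != 0 by apply: contraNneq S0 => <-.
  by rewrite y0 mulf_neq0 ?invr_neq0 // tS invf_div mulrCA mulfV // mulr1 !eqxx.
move: #|S| => n; lia.
Qed.

End AddMulGraph.

Section FieldXsq1.

Variables (p : nat) (p_pr : prime p) (p_mod4 : (p %% 4 = 3)%N).

Let p_eq : p = (2 * (2 * (p %/ 4) + 1)).+1.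
Proof. by rewrite {1}(divn_eq p 4) p_mod4 mulnDr mulnA mulnC addnS. Qed.

Let two_neq0 : 2 != 0 :> 'F_p.
Proof.
have p_gt2 : (2 < p)%N by move: p_mod4 (prime_gt1 p_pr); case: p => [|[|[|]]].
by rewrite -(dvdn_pcharf (pchar_Fp p_pr)) gtnNdvd.
Qed.

Let exprp (R : pzRingType) (a : R) : a ^+ 2 = -1 -> a ^+ p = - a.
Proof.
move=> a2; rewrite [X in a ^+ X]p_eq exprS exprM a2 exprD exprM sqrrN.
by rewrite !expr1n mul1r expr1 mulrN1.
Qed.

Lemma Xsq1_monic_irreducible :
  monic_irreducible_poly ('X^2 + 1 : {poly 'F_p}).
Proof.
have sz : size ('X^2 + 1 : {poly 'F_p}) = 3%N by exact: size_XnaddC.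
split; last exact: monicXnaddC.
apply: cubic_irreducible; first by rewrite sz.
move=> x; apply/negP; rewrite /root !hornerE addr_eq0 => /eqP x2.
have := expf_card x; rewrite card_Fp // (exprp x2) => /eqP.
rewrite eq_sym -addr_eq0 -mulr2n -mulr_natl mulf_eq0 (negPf two_neq0) /=.
move=> /eqP x0.
by move/eqP: x2; rewrite x0 expr0n /= eq_sym oppr_eq0 oner_eq0.
Qed.

Definition Kf : finFieldType :=
  {poly %/ ('X^2 + 1 : {poly 'F_p}) with Xsq1_monic_irreducible}.

Definition xf : Kf := 'qX.

(* Equals {xf, - xf}, see [xf_expp]. *)
Definition Sf : {set Kf} := [set xf; xf ^+ p].

Definition Xf : multigraph := add_mul_graph Sf.

Lemma card_Kf : #|Kf| = (p ^ 2)%N.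
Proof. by rewrite card_qfpoly card_Fp // size_XnaddC. Qed.

Lemma xf_sqr : xf ^+ 2 = -1.
Proof.
apply/eqP; rewrite -addr_eq0; apply/eqP.
set h := ('X^2 + 1 : {poly 'F_p}).
have : in_qpoly h h = 0.
  apply: val_inj; rewrite /= mk_monicE; last exact: Xsq1_monic_irreducible.
  by rewrite rmodpp //; case: Xsq1_monic_irreducible.
by rewrite -(in_qpoly1 h) [xf ^+ 2](esym (in_qpolyM h 'X 'X)) -in_qpolyD -expr2.
Qed.

Lemma xf_expp : xf ^+ p = - xf.
Proof. exact: exprp xf_sqr. Qed.

Lemma Xf_regular : regular 8 Xf.
Proof.
have x0 : xf != 0.
  apply/eqP => x0; move/eqP: xf_sqr.
  by rewrite x0 expr0n /= eq_sym oppr_eq0 oner_eq0.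
have S2 : #|Sf| = 2%N.
  rewrite cards2 xf_expp; case: eqVneq => // /(congr1 (fun q : Kf => (val q)`_1)).
  have sz : size ('X^2 + 1 : {poly 'F_p}) = 3%N by exact: size_XnaddC.
  have valX : val xf = 'X by rewrite [LHS]qpolyXE ?sz //; exact: monicXnaddC.
  rewrite [val (- xf)]/(- val xf) valX coefN coefX /= => /eqP.
  by rewrite -addr_eq0 -mulr2n (negPf two_neq0).
have S0 : 0 \notin Sf.
  by rewrite !inE ![0 == _]eq_sym xf_expp oppr_eq0 (negPf x0).
by have := add_mul_graph_regular S0; rewrite S2.
Qed.

End FieldXsq1.

(* Main.v *)
(** Write the elements of [K_f] as [a + b x]. Multiplication by [x] sends [(a, b)]
    to [(-b, a)], so multiplicative edges are quarter turns of the torus [F_p^2]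
    while additive edges are the steps [b -> b +- 1]. The function
    [cos (2 pi a / p) * cos (2 pi b / p)] is invariant under quarter turns, hence
    only the additive edges contribute to its Laplacian, and it is an
    eigenfunction for the eigenvalue [4 (1 - cos (2 pi / p))]. This is positive
    and tends to [0]; since constants give the eigenvalue [0], it bounds the
    second smallest eigenvalue from above. *)

Require Import Defs.
From mathcomp Require Import all_boot all_order all_algebra.
From mathcomp Require Import qfpoly polyrcf zify ring.
From mathcomp Require Import reals topology normedtype trigo.
Import Order.TTheory GRing.Theory Num.Theory.
Import numFieldNormedType.Exports.
Local Open Scope ring_scope.

(** * Infinitely many primes congruent to 3 modulo 4 *)

(** Since [n] is odd, a smallest prime factor not congruent to 3 is congruent to 1 modulo 4; the
    cofactor is then congruent to 3 and smaller than [n]. *)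
Lemma prime_3mod4_dvd (n : nat) :
  (n %% 4 = 3)%N -> exists p, [/\ prime p, (p %% 4 = 3)%N & (p %| n)%N].
Proof.
have [k] := ubnP n; elim: k n => // k IHk n; rewrite ltnS => le_nk n3.
have n_gt1 : (1 < n)%N by case: n n3 {le_nk} => [|[|]].
have [d3|d3] := eqVneq (pdiv n %% 4)%N 3.
  by exists (pdiv n); rewrite pdiv_prime ?pdiv_dvd.
have nE := divnK (pdiv_dvd n); set d := pdiv n in nE d3.
have d_gt1 : (1 < d)%N by rewrite prime_gt1 ?pdiv_prime.
case: (IHk (n %/ d)%N) => [||p [p_pr p3 pn]].
- by apply: leq_trans le_nk; rewrite ltn_Pdiv // ltnW.
- rewrite -{1}nE -modnMml -modnMmr in n3; move: d3 n3.
  have: (d %% 4 < 4)%N by rewrite ltn_mod.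
  have: ((n %/ d) %% 4 < 4)%N by rewrite ltn_mod.
  by case: (d %% 4)%N => [|[|[|[|]]]] //; case: ((n %/ d) %% 4)%N => [|[|[|[|]]]].
- by exists p; split=> //; rewrite -nE dvdn_mulr.
Qed.

Lemma prime_3mod4_gt (n : nat) :
  exists p, [/\ prime p, (p %% 4 = 3)%N & (n < p)%N].
Proof.
have fact_gt := fact_gt0 n.
(* Euclid's argument with [4 n! - 1]. *)
have [|p [p_pr p3 pn]] := @prime_3mod4_dvd (4 * n`!).-1; first by lia.
exists p; split=> //; rewrite ltnNge; apply/negP => le_pn.
have : (p %| 4 * n`!)%N by rewrite dvdn_mull // dvdn_fact // prime_gt0.
rewrite -[(4 * _)%N]prednK ?muln_gt0 // -addn1 dvdn_addr // dvdn1 => /eqP p1.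
by rewrite p1 in p_pr.
Qed.

(** * Spectrum of a graph Laplacian *)

Lemma root_char_poly_laplacian (R : realType) (G : multigraph)
    (g : {ffun vertex G -> R}) (a : R) (y0 : vertex G) :
  (forall y, laplacian g y = a * g y) -> g y0 != 0 ->
  root (char_poly (laplacian_mx R G)) a.
Proof.
move=> g_eig gy0; set A := laplacian_mx R G.
(* [eigenvalue] refers to row vectors. *)
have -> : char_poly A = char_poly A^T.
  rewrite /char_poly -det_tr; congr (\det _); apply/matrixP=> i j.
  by rewrite !mxE eq_sym.
rewrite -eigenvalue_root_char; apply/eigenvalueP.
exists (\row_i g (enum_val i)); last first.
  apply: contraNneq gy0 => /rowP/(_ (enum_rank y0)).
  by rewrite !mxE enum_rankK => ->.
(* Expansion of [g] in indicator functions; by linearity it turns the product with the matrix into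
   [laplacian g]. *)
have deltaE z : \sum_(j < #|vertex G|)
    g (enum_val j) * (z == enum_val j)%:R = g z.
  rewrite -(big_enum_val (A := vertex G) (fun x => g x * (z == x)%:R)) /=.
  rewrite (bigD1 z) //= eqxx mulr1 big1 ?addr0 // => x xz.
  by rewrite eq_sym (negPf xz) mulr0.
apply/rowP=> i; rewrite !mxE -g_eig ffunE.
under eq_bigr => j _ do rewrite !mxE ffunE mulrDr !mulr_sumr.
rewrite big_split /=.
by congr (_ + _); rewrite exchange_big; apply: eq_bigr => e _;
  under eq_bigr => j _ do rewrite !ffunE mulrBr;
  rewrite sumrB !deltaE.
Qed.

Lemma mem_eigenvalues (R : realType) (n : nat) (A : 'M[R]_n) (a : R) :
  (a \in eigenvalues A) = root (char_poly A) a.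
Proof.
have p0 : char_poly A != 0 by rewrite monic_neq0 ?char_poly_monic.
have rootsE b : (b \in rootsR (char_poly A)) = root (char_poly A) b.
  by rewrite -(roots_on_rootsR p0 b) in_itv.
apply/flatten_mapP/idP => [[b]|ra].
  by rewrite rootsE mem_nseq => rb /andP[_ /eqP->].
exists a; first by rewrite rootsE.
by rewrite mem_nseq eqxx andbT -XsubC_dvd // -root_factor_theorem.
Qed.

Lemma sorted_eigenvalues (R : realType) (n : nat) (A : 'M[R]_n) :
  sorted <=%R (eigenvalues A).
Proof.
rewrite /eigenvalues.
set q := char_poly A.
have := sorted_roots (- cauchy_bound q) (cauchy_bound q) q.
rewrite -/(rootsR _) !sorted_pairwise; [|exact: le_trans|exact: lt_trans].
elim: (rootsR _) => //= a s IHs /andP[/allP a_s /IHs s_s].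
rewrite pairwise_cat s_s andbT; apply/andP; split.
  apply/allrelP => b c /nseqP[-> _] /flatten_mapP[d ds /nseqP[-> _]].
  exact/ltW/a_s.
by elim: (mup a q) => //= k ->; rewrite andbT; apply/allP => b /nseqP[->].
Qed.

(** In the sorted list of eigenvalues [b] cannot stand first, because the smaller [a] occurs too; so
    the entry at index 1 is at most [b]. *)
Lemma lambda1_le (R : realType) (G : multigraph) (a b : R) : a < b ->
  root (char_poly (laplacian_mx R G)) a ->
  root (char_poly (laplacian_mx R G)) b -> lambda1 R G <= b.
Proof.
move=> lt_ab; rewrite -!mem_eigenvalues /lambda1.
set s := eigenvalues _ => a_s b_s.
have nth_le := sorted_leq_nth le_trans lexx 0
  (sorted_eigenvalues _ _ (laplacian_mx R G)).
have b_gt0 : (0 < index b s)%N.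
  rewrite ltnNge leqn0; apply: contraTN lt_ab => /eqP b0.
  rewrite -leNgt -(nth_index 0 a_s) -{1}(nth_index 0 b_s).
  by apply: nth_le; rewrite ?inE ?index_mem // b0.
rewrite -[leRHS](nth_index 0 b_s); apply: nth_le => //; rewrite inE ?index_mem //.
(* Index 1 lies inside the list, so [lambda1] is not the default value 0 here. *)
by apply: leq_ltn_trans b_gt0 _; rewrite index_mem.
Qed.

(** * Laplacian of the additive-multiplicative graph *)

(** Once one endpoint is fixed, the label determines an additive edge, and [h] recovers it. This
    serves both for a fixed source and for a fixed target. *)
Lemma sum_add_edge (K : finFieldType) (S : {set K}) (V : nmodType)
    (Q : pred (K * K * K)) (h : K -> K * K * K) (F : K * K * K -> V) :
  (forall s, (h s).2 = s) -> (forall s, (h s).1.2 - (h s).1.1 = s) ->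
  (forall t : K * K * K, t.1.2 - t.1.1 = t.2 -> Q t = (h t.2 == t)) ->
  \sum_(e : add_edge S | Q (val e)) F (val e) = \sum_(s in S) F (h s).
Proof.
move=> h2 h1 QE; pose P (e : K * K * K) := (e.2 \in S) && (e.1.2 - e.1.1 == e.2).
have Ph s : s \in S -> P (h s) by rewrite /P h2 h1 eqxx andbT.
(* [h s] is an edge only for [s] in [S], hence a partial inverse through [insub]. *)
rewrite [RHS](reindex_omap (fun e : add_edge S => (val e).2)
  (fun s => insub (h s))) => [|s sS]; last first.
  by case: insubP => [e _ /= ->|/negP[]]; [rewrite h2 | apply: Ph].
apply: eq_big => [e|e]; case/andP: (valP e) => eS /eqP e2; rewrite (QE _ e2).
  rewrite eS /=; apply/eqP/eqP => [->|]; first by rewrite valK.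
  by case: insubP => // u _ <- [->].
by move/eqP->.
Qed.

(** By invariance [g] agrees at both ends of a multiplicative edge. The two remaining sums come from
    the additive edges leaving and entering [y]. *)
Lemma laplacian_add_mul_graph (K : finFieldType) (S : {set K}) (R : realType)
    (g : {ffun K -> R}) (y : K) :
  (forall s z : K, s \in S -> g (s * z) = g z) ->
  laplacian (G := add_mul_graph S) g y =
    \sum_(s in S) (g y - g (y + s)) + \sum_(s in S) (g y - g (y - s)).
Proof.
move=> g_inv; rewrite ffunE !big_sumType /=.
have mulE (e : mul_edge S) : g (val e).1.2 = g (val e).1.1.
  case: e => [[[u v] s] /= /and4P[u0 _ sS /eqP vE]].
  by rewrite -(g_inv s u sS) -vE mulfVK.
have loopE : \sum_(e < #|S| | 0 == y) (g y - g 0) = 0.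
  by apply: big1 => e /eqP->; rewrite subrr.
rewrite !loopE !addr0.
rewrite [X in _ + X + _]big1 ?addr0 => [|e /eqP<-]; last by rewrite mulE subrr.
rewrite [X in _ + (_ + X)]big1 ?addr0 => [|e /eqP<-]; last by rewrite mulE subrr.
congr (_ + _).
  apply: (sum_add_edge _ _ _ (fun t => t.1.1 == y) (fun s => (y, y + s, s))
    (fun t => g y - g t.1.2)) => // [s|[[u v] s]] /=; first by rewrite addrC addKr.
  move=> <-; apply/eqP/eqP => [->|[->//]].
  by rewrite addrC subrK.
apply: (sum_add_edge _ _ _ (fun t => t.1.2 == y) (fun s => (y - s, y, s))
  (fun t => g y - g t.1.1)) => // [s|[[u v] s]] /=; first by rewrite subKr.
move=> <-; apply/eqP/eqP => [->|[]//].
by rewrite subKr.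
Qed.

(** * Coordinates on [K] over the prime field *)

Section Coordinates.
Variables (p : nat) (p_pr : prime p) (p_mod4 : (p %% 4 = 3)%N).
Local Notation K := (Kf p_pr p_mod4).
Local Notation x := (xf p_pr p_mod4).
Local Notation h := ('X^2 + 1 : {poly 'F_p}).

(* The class of [a + b x] has coordinates [a] and [b] at [0] and [1]. *)
Definition coord_f (i : nat) (y : K) : 'F_p := (val y)`_i.

Lemma coord_fD i (y z : K) : coord_f i (y + z) = coord_f i y + coord_f i z.
Proof. exact: coefD. Qed.

Lemma coord_fN i (y : K) : coord_f i (- y) = - coord_f i y.
Proof. exact: coefN. Qed.

Lemma size_Xsq1 : size h = 3%N.
Proof. exact: size_XnaddC. Qed.

Lemma val_xf : val x = 'X.
Proof. by rewrite [LHS]qpolyXE ?size_Xsq1 //; apply: monicXnaddC. Qed.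

Lemma coord_xf i : coord_f i x = (i == 1%N)%:R.
Proof. by rewrite /coord_f val_xf coefX. Qed.

Lemma val_xfM (y : K) :
  val (x * y) = (- coord_f 1 y)%:P + coord_f 0 y *: 'X.
Proof.
have hE : mk_monic h = h by apply: mk_monicE; apply: Xsq1_monic_irreducible.
have sz_y : (size (val y) < 3)%N.
  have <- : size (mk_monic h) = 3%N by rewrite hE; apply: size_Xsq1.
  exact: size_mk_monic.
have yE : val y = (coord_f 0 y)%:P + coord_f 1 y *: 'X.
  apply/polyP=> [[|[|i]]]; rewrite !(coefD, coefC, coefZ, coefX) /=.
  - by rewrite mulr0 addr0.
  - by rewrite mulr1 add0r.
  - by rewrite mulr0 addr0 nth_default // -ltnS (leq_trans sz_y).
have -> : val (x * y) = Pdiv.CommonRing.rmodp (val x * val y) (mk_monic h) by [].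
rewrite val_xf yE hE.
set a := coord_f 0 y; set b := coord_f 1 y.
(* Division with remainder by [h]: the quotient [b] removes the quadratic term. *)
have -> : 'X * (a%:P + b *: 'X) = b%:P * h + ((- b)%:P + a *: 'X) :> {poly 'F_p}.
  by rewrite -!mul_polyC polyCN; ring.
rewrite Pdiv.RingMonic.rmodp_addl_mul_small //; first exact: monicXnaddC.
rewrite size_Xsq1 (leq_ltn_trans (size_polyD _ _)) // gtn_max.
rewrite (leq_ltn_trans (size_polyC_leq1 _)) //.
by rewrite (leq_ltn_trans (size_scale_leq _ _)) // size_polyX.
Qed.

Lemma coord_xfM0 (y : K) : coord_f 0 (x * y) = - coord_f 1 y.
Proof. by rewrite {1}/coord_f val_xfM coefD coefC coefZ coefX mulr0 addr0. Qed.

Lemma coord_xfM1 (y : K) : coord_f 1 (x * y) = coord_f 0 y.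
Proof. by rewrite {1}/coord_f val_xfM coefD coefC coefZ coefX mulr1 add0r. Qed.
End Coordinates.

Arguments coord_f {p p_pr p_mod4}.

(** * Cosines on the cyclic group of order [p] *)

Section Cosine.
Variables (R : realType) (p : nat) (p_pr : prime p).

Let p0 : p%:R != 0 :> R.
Proof. by rewrite pnatr_eq0 -lt0n prime_gt0. Qed.

Definition angle : R := pi *+ 2 / p%:R.

Definition cos_Fp (a : 'F_p) : R := cos (angle *+ (a : nat)).

Lemma angle_p : angle *+ p = pi *+ 2.
Proof. by rewrite -mulr_natr divfK. Qed.

(** [p] times the angle is a full turn, so any natural representative of a residue may be used. *)
Lemma cos_Fp_nat (n : nat) : cos_Fp n%:R = cos (angle *+ n).
Proof.
rewrite /cos_Fp val_Fp_nat // [in RHS](divn_eq n p) addnC mulrnDr mulnC mulrnA.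
by rewrite angle_p periodicn //; apply: cosD2pi.
Qed.

Lemma cos_FpN (a : 'F_p) : cos_Fp (- a) = cos_Fp a.
Proof.
have le_ap : (a <= p)%N by rewrite ltnW // -[X in (_ < X)%N](Fp_cast p_pr).
have -> : - a = (p - a)%:R.
  by rewrite natrB // pchar_Fp_0 // sub0r natr_Zp.
by rewrite cos_Fp_nat mulrnBr // angle_p addrC cosD2pi cosN.
Qed.

Lemma cos_FpD1 (a : 'F_p) :
  cos_Fp (a + 1) + cos_Fp (a - 1) = cos angle * cos_Fp a *+ 2.
Proof.
have -> : a + 1 = a.+1%:R by rewrite -[in RHS]natr1 natr_Zp.
(* [p.-1] represents -1 and keeps the multiple of the angle a natural number. *)
have -> : a - 1 = (a + p.-1)%:R.
  rewrite natrD natr_Zp; congr (_ + _); apply/eqP.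
  by rewrite eq_sym -subr_eq0 opprK natr1 prednK ?prime_gt0 // pchar_Fp_0.
rewrite !cos_Fp_nat mulrnDr -subn1 mulrnBr ?prime_gt0 // angle_p addrCA addrC.
rewrite [X in _ + X]cosD2pi -[a.+1]addn1 mulrnDr cosB cosD /cos_Fp.
by rewrite mulr1n; ring.
Qed.
End Cosine.

(** * The eigenfunction *)

Lemma laplacian_Xf (R : realType) (p : nat) (p_pr : prime p)
    (p_mod4 : (p %% 4 = 3)%N) (y : Kf p_pr p_mod4) :
  let g : {ffun Kf p_pr p_mod4 -> R} :=
    [ffun z => cos_Fp R p (coord_f 0 z) * cos_Fp R p (coord_f 1 z)] in
  laplacian (G := Xf p_pr p_mod4) g y = 4 * (1 - cos (angle R p)) * g y.
Proof.
move=> g; set x := xf p_pr p_mod4.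
have g_even z : g (- z) = g z by rewrite !ffunE !coord_fN !cos_FpN.
have gxM z : g (x * z) = g z.
  by rewrite !ffunE coord_xfM0 coord_xfM1 cos_FpN // mulrC.
rewrite laplacian_add_mul_graph => [|s z]; last first.
  by rewrite !inE xf_expp => /orP[] /eqP->; rewrite ?mulNr ?g_even gxM.
(* Adding [x] or [- x] moves only the second coordinate, by 1 or -1. *)
have gD : g (y + x) + g (y - x) = cos (angle R p) * g y *+ 2.
  rewrite !ffunE !coord_fD !coord_fN !coord_xf /= oppr0 !addr0 -mulrDr.
  by rewrite cos_FpD1 // mulrCA mulrnAr.
(* Needed for [Sf] to have two elements: each of [x], [- x] then occurs in both sums, whence the
   factor 4. *)
have x_neq : x != - x.
  apply/eqP => /(congr1 (coord_f 1)).
  rewrite coord_fN coord_xf /= => /eqP; rewrite -addr_eq0 -mulr2n.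
  rewrite -(dvdn_pcharf (pchar_Fp p_pr)) dvdn_prime2 // => /eqP p2.
  by have := p_mod4; rewrite p2.
rewrite /Sf xf_expp !big_setU1 ?inE //= !big_set1 opprK.
have -> : g (y - x) = cos (angle R p) * g y *+ 2 - g (y + x).
  by rewrite -gD addrAC subrr add0r.
by ring.
Qed.

(** * Eigenvalues tending to 0 *)

Lemma cos_near0 (R : realType) (eps : R) : 0 < eps ->
  exists2 d, 0 < d & forall t, 0 < t < d -> 1 - cos t < eps.
Proof.
move=> eps0.
have /cvgrPdist_lt/(_ _ eps0) := @continuous_cos R 0.
rewrite cos0 => /nbhs_ballP[d /= d0 dP]; exists d => // t /andP[t0 td].
apply: le_lt_trans (ler_norm _) (dP _ _).
by rewrite /ball /= sub0r normrN gtr0_norm.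
Qed.

Theorem theorem7 (R : realType) :
  ~ (exists eps : R, 0 < eps /\
      forall (p : nat) (p_pr : prime p) (p_mod4 : (p %% 4 = 3)%N),
        eps <= lambda1 R (Xf p_pr p_mod4)).
Proof.
case=> eps [eps0 le_eps].
have [|d d0 dP] := @cos_near0 R (eps / 4); first by rewrite divr_gt0.
(* This bound on [p] makes the angle smaller than [d]. *)
have [p [p_pr p3 lt_p]] := prime_3mod4_gt (Num.truncn (pi *+ 2 / d)).
have p_gt0 : 0 < p%:R :> R by rewrite ltr0n prime_gt0.
have p_ge2 : 2 <= p%:R :> R by rewrite ler_nat prime_gt1.
have pi2_gt0 : 0 < (pi : R) *+ 2 by rewrite mulrn_wgt0 // pi_gt0.
have angle_gt0 : 0 < angle R p by rewrite divr_gt0.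
have angle_lt : angle R p < d.
  rewrite ltr_pdivrMr // mulrC -ltr_pdivrMr //.
  by apply: lt_le_trans (truncnS_gt _) _; rewrite ler_nat.
(* On [0, pi] the cosine is strictly decreasing, so the eigenvalue is positive and hence differs
   from that of the constants. *)
have angle_le : angle R p <= pi.
  by rewrite ler_pdivrMr // -[pi *+ 2]mulr_natr ler_wpM2l // pi_ge0.
have cos_lt1 : cos (angle R p) < 1.
  by rewrite -cos0 ltr_cos ?in_itv /= ?pi_ge0 ?lexx ?angle_le ?(ltW angle_gt0).
have := le_eps p p_pr p3; apply/negP; rewrite -ltNge.
apply: (@le_lt_trans _ _ (4 * (1 - cos (angle R p)))); last first.
  by rewrite mulrC -ltr_pdivlMr // dP // angle_gt0.
apply: (lambda1_le R _ 0); first by rewrite mulr_gt0 // subr_gt0.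
- apply: (root_char_poly_laplacian R (Xf p_pr p3) [ffun=> 1] _ (0 : Kf p_pr p3)).
    move=> y; rewrite !ffunE mul0r !big1 ?addr0 // => e _;
      by rewrite !ffunE subrr.
  by rewrite ffunE oner_eq0.
- apply: (root_char_poly_laplacian R (Xf p_pr p3) _ _ (0 : Kf p_pr p3)).
    by move=> y; apply: laplacian_Xf.
  rewrite ffunE /coord_f !coef0 /cos_Fp /= mulr0n cos0 mulr1.
  exact: oner_neq0.
Qed.
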